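(* Let $A\in\mathbb{R}^{n\times n}$ be such that the directed graph $\mathcal{G}(A)$ is structurally balanced, with nodes split into clusters $\mathcal{V}_1$ and $\mathcal{V}_2$. Let $\mathcal{L}\subset\{1,\dots,n\}$ be the set of leaders, and let $B\in\mathbb{R}^{n\times m}$, with $m=|\mathcal{L}|<n$, be the selection matrix whose columns are the canonical vectors $\mathbf{e}_\ell$, $\ell\in\mathcal{L}$. Assume that $\mathcal{L}$ intersects both $\mathcal{V}_1$ and $\mathcal{V}_2$. If (a) for every $i\in\mathcal{V}_1\setminus\mathcal{L}$ there exists $\ell\in\mathcal{L}\cap\mathcal{V}_1$ such that $d(\ell,i)<d(\ell,j)$ for all $j\in\mathcal{V}_2\setminus\mathcal{L}$; (b) for every $i\in\mathcal{V}_2\setminus\mathcal{L}$ there exists $\ell\in\mathcal{L}\cap\mathcal{V}_2$ such that $d(\ell,i)<d(\ell,j)$ for all $j\in\mathcal{V}_1\setminus\mathcal{L}$; then the pair $(A,B)$ is herdable.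
   Context: Graph of a matrix: for $A\in\mathbb{R}^{n\times n}$, $\mathcal{G}(A)$ is the signed weighted directed graph with node set $\{1,\dots,n\}$ and an arc $(j,i)$ from $j$ to $i$ if and only if $[A]_{ij}\neq 0$, with weight $[A]_{ij}$. A walk of length $q$ from $j$ to $i$ is a sequence of $q$ consecutive arcs leading from $j$ to $i$. The distance $d(j,i)$ is the minimum length of a walk from $j$ to $i$, with $d(j,i)=+\infty$ if there is none. Structural balance: $\mathcal{G}(A)$ is structurally balanced if all its nodes can be partitioned into two disjoint subsets (clusters) $\mathcal{V}_1,\mathcal{V}_2$ such that $[A]_{ij}\ge 0$ whenever $i,j$ belong to the same subset, and $[A]_{ij}\le 0$ whenever $i,j$ belong to different subsets. Leaders: the leaders are the nodes to which an external input is directly applied, i.e. the indices of the nonzero rows of the selection matrix $B$ (a selection matrix is an $n\times m$ submatrix of the identity matrix $I_n$). Herdability: a pair $(A,B)$, $A\in\mathbb{R}^{n\times n}$, $B\in\mathbb{R}^{n\times m}$, describing a linear time-invariant (continuous-time or discrete-time) system $\dot{\mathbf x}=A\mathbf{x}+B\mathbf{u}$ or $\mathbf{x}(t+1)=A\mathbf{x}(t)+B\mathbf{u}(t)$, is herdable if for every $\mathbf{x}(0)$ and every $h>0$ there exist $t_f>0$ and an input $\mathbf{u}(t)$, $t\in[0,t_f)$, driving the state from $\mathbf{x}(0)$ to $\mathbf{x}(t_f)\ge h\mathbf{1}_n$ (entrywise, where $\mathbf{1}_n$ is the vector of all ones). It is known that this is equivalent to the image of the controllability matrix $\mathcal{R}(A,B)=[B\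 \ AB\ \ \cdots\ \ A^{n-1}B]$ containing a vector with all entries strictly positive.
   Formalization: Conditions (a) and (b) additionally require d(ℓ,i) to be finite; this matters only when the other cluster has no non-leaders, where the claim as written fails (e.g. n=3, A=0, V1={1,3}, V2={2}, L={1,2}). *)

(* Defs.v *)
From mathcomp Require Import all_boot all_order all_algebra.
From mathcomp Require Import all_classical all_reals all_analysis.

Set Implicit Arguments.
Unset Strict Implicit.
Unset Printing Implicit Defensive.

Import Order.TTheory GRing.Theory Num.Theory.
Import numFieldNormedType.Exports.

Local Open Scope classical_set_scope.
Local Open Scope ring_scope.

Section GraphOfMatrix.
Context {R : realType} {n : nat}.
Implicit Type A : 'M[R]_n.

(* The entry A i j is the weight of the arc from j to i. *)
Definition arc A : rel 'I_n := fun j i => A i j != 0.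

Definition walk A (q : nat) (j i : 'I_n) : Prop :=
  exists p : seq 'I_n, [/\ size p = q, path (arc A) j p & last j p = i].

(* The infimum is taken over a set of natural numbers, so it is a minimum
   when a walk exists, and it is +oo otherwise.  The empty walk is allowed,
   hence dist A j j = 0. *)
Definition dist A (j i : 'I_n) : \bar R :=
  ereal_inf [set (q%:R)%:E | q in [set q : nat | walk A q j i]].

Definition structurally_balanced_with A (V1 V2 : {set 'I_n}) : Prop :=
  [/\ (V1 :|: V2 = [set: 'I_n])%SET,
      (V1 :&: V2 = finset.set0)%SET,
      forall i j, (i \in V1) && (j \in V1) || (i \in V2) && (j \in V2) ->
        0 <= A i j
    & forall i j, (i \in V1) && (j \in V2) || (i \in V2) && (j \in V1) ->
        A i j <= 0].

End GraphOfMatrix.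

(* The columns of the identity matrix indexed by L, in increasing order. *)
Definition selection_mx (R : realType) (n : nat) (L : {set 'I_n}) :
    'M[R]_(n, #|L|) :=
  colsub (fun k : 'I_#|L| => enum_val k) 1%:M.

Section Herdability.
Context {R : realType} {n m : nat}.
Context (A : 'M[R]_n) (B : 'M[R]_(n, m)).

(* Continuity of x on the closed interval ties the endpoint values x 0 and
   x tf to the differential equation, which is imposed on the open interval. *)
Definition ct_trajectory (tf : R) (u : R -> 'cV[R]_m) (x : R -> 'cV[R]_n) :
    Prop :=
  [/\ forall k, {within `[0, tf], continuous (fun t => u t k 0)},
      forall i, {within `[0, tf], continuous (fun t => x t i 0)}
    & forall t, 0 < t < tf -> forall i,
        is_derive t (1 : R) (fun s => x s i 0)
          ((A *m x t + B *m u t) i 0)].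

Definition ct_herdable : Prop :=
  forall (x0 : 'cV[R]_n) (h : R), 0 < h ->
    exists (tf : R) (u : R -> 'cV[R]_m) (x : R -> 'cV[R]_n),
      [/\ 0 < tf, ct_trajectory tf u x, x 0 = x0
        & forall i, h <= x tf i 0].

Definition dt_trajectory (tf : nat) (u : nat -> 'cV[R]_m)
    (x : nat -> 'cV[R]_n) : Prop :=
  forall t, (t < tf)%N -> x t.+1 = A *m x t + B *m u t.

Definition dt_herdable : Prop :=
  forall (x0 : 'cV[R]_n) (h : R), 0 < h ->
    exists (tf : nat) (u : nat -> 'cV[R]_m) (x : nat -> 'cV[R]_n),
      [/\ (0 < tf)%N, dt_trajectory tf u x, x 0%N = x0
        & forall i, h <= x tf i 0].

(* The pair describes either kind of system, so both are required. *)
Definition herdable : Prop := ct_herdable /\ dt_herdable.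

End Herdability.

(* Main.v *)
(* Let [i] be a follower of the first cluster, [l] its leader from condition (a)
   and [q] the distance from [l] to [i].  Structural balance makes the column
   [A^q e_l] nonnegative on the followers, since no walk of length [q] from [l]
   ends at a follower of the other cluster, and its [i]-th entry is positive.
   Summing these columns over all followers and adding a large multiple of
   [e_l] for each leader [l] gives a positive vector in the span of the
   [A^k B], [k < n].

   In discrete time such a vector is reached from 0 at time [n].  In continuous
   time it is reached at time 1 by a polynomial trajectory: by Cayley-Hamilton,
   [p(D) psi] is an input reaching a combination of the [A^k b], where [p] is
   the characteristic polynomial and [psi] any polynomial that is flat at 0, and
   the [psi] with roots of increasing order at 1 give a triangular system for
   the [A^k b].  In both cases one adds a large multiple of this trajectory to
   the free response to the initial state. *)

Require Import Defs.
From mathcomp Require Import all_boot all_order all_algebra.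
From mathcomp Require Import all_classical all_reals all_analysis.

Set Implicit Arguments.
Unset Strict Implicit.
Unset Printing Implicit Defensive.

Import Order.TTheory GRing.Theory Num.Theory.
Import numFieldNormedType.Exports.

Local Open Scope ring_scope.

(** * Matrix powers, walks and distances *)

Lemma exprmxSE (R : pzSemiRingType) n (A : 'M[R]_n) k i j :
  (A ^+ k.+1) i j = \sum_h A i h * (A ^+ k) h j.
Proof. by rewrite exprS mxE. Qed.

Section Walks.
Context {R : realType} {n : nat} (A : 'M[R]_n).

Let absA : 'M[R]_n := map_mx Num.norm A.

Lemma walkS q l i :
  walk A q.+1 l i <-> exists2 h, walk A q l h & A i h != 0.
Proof.
split=> [[p [sp pp lp]]|[h [p [sp pp lp]] hi]].
- elim/last_ind: p sp pp lp => // p x _; rewrite size_rcons last_rcons.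
  move=> [sp]; rewrite rcons_path => /andP[pp px] <-.
  by exists (last l p) => //; exists p.
- exists (rcons p i); rewrite size_rcons sp last_rcons rcons_path pp lp.
  by split.
Qed.

Lemma exp_absmx_ge0 k i j : 0 <= (absA ^+ k) i j.
Proof.
elim: k i j => [|k IH] i j; first by rewrite expr0 mxE; case: eqP.
by rewrite exprmxSE sumr_ge0 // => h _; rewrite mulr_ge0 // mxE.
Qed.

(** The entries of [absA] are nonnegative, so the contributions of different walks cannot cancel. *)
Lemma exp_absmx_gt0 q l i : 0 < (absA ^+ q) i l <-> walk A q l i.
Proof.
elim: q i => [|q IH] i.
  rewrite expr0 mxE; split=> [|[[|x p] [//= _ _ ->]]]; last by rewrite eqxx.
  by case: eqP => [->|]; [exists [::] | rewrite ltxx].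
rewrite walkS exprmxSE; split=> [|[h wh hi]].
- rewrite lt0r => /andP[/eqP + _] => nz0; apply: contra_notP nz0 => nowalk.
  apply: big1 => h _; rewrite mxE.
  have [->|hi] := eqVneq (A i h) 0; first by rewrite normr0 mul0r.
  have /negP : ~ (0 < (absA ^+ q) h l) by move/IH => wh; apply: nowalk; exists h.
  by rewrite lt0r exp_absmx_ge0 andbT negbK => /eqP ->; rewrite mulr0.
- rewrite (bigD1 h) //= ltr_pwDl //.
    by rewrite mulr_gt0 ?mxE ?normr_gt0 //; apply/IH.
  by rewrite sumr_ge0 // => k _; rewrite mulr_ge0 ?exp_absmx_ge0 // mxE.
Qed.

(** With [D] the diagonal matrix of the signs [s], [A = D absA D] and [D ^+ 2 = 1], so the inner
    factors [D] cancel in every power. *)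
Lemma exp_signed_mx (s : 'I_n -> R) :
    (forall i, s i * s i = 1) -> (forall i j, A i j = s i * s j * absA i j) ->
  forall k i j, (A ^+ k) i j = s i * s j * (absA ^+ k) i j.
Proof.
move=> ss As; elim=> [|k IH] i j.
  rewrite !expr0 !mxE; case: eqP => [->|_]; last by rewrite mulr0.
  by rewrite ss mul1r.
rewrite !exprmxSE mulr_sumr; apply: eq_bigr => h _.
rewrite IH As mulrACA (_ : s i * s h * (s h * s j) = s i * s j) //.
by rewrite mulrA -(mulrA (s i)) ss mulr1.
Qed.

Lemma dist_attained l i : (dist A l i < +oo)%E ->
  exists q, [/\ (q < n)%N, walk A q l i & dist A l i = (q%:R)%:E].
Proof.
move=> /ereal_inf_lt[_ [q0 /= wq0 _] _].
have exw : exists q, `[< walk A q l i >] by exists q0; apply/asboolP.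
case: (ex_minnP exw) => q /asboolP wq q_min.
have {}q_min k : walk A k l i -> (q <= k)%N by move=> /asboolP/q_min.
exists q; split => //.
- case: wq => p [sp pp lp].
  (* A shortest walk may be replaced by one without repeated nodes; it visits at most [n] nodes,
     start included, hence has fewer than [n] arcs. *)
  move: lp; case/shortenP: pp => p' pp' up' _ lp.
  apply: (@leq_ltn_trans (size p')); first by apply: q_min; exists p'; split.
  have := max_card (mem (l :: p')).
  by rewrite card_ord (card_uniqP up').
- apply/le_anti/andP; split.
  + by apply: ereal_inf_lbound; exists q.
  + by apply: le_ereal_inf_tmp => _ [k /= wk <-]; rewrite lee_fin ler_nat q_min.
Qed.

End Walks.

Lemma structurally_balancedC (R : realType) n (A : 'M[R]_n) V1 V2 :
  structurally_balanced_with A V1 V2 -> structurally_balanced_with A V2 V1.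
Proof.
case=> cov disj same diff.
split; [by rewrite finset.setUC | by rewrite finset.setIC | |] => i j.
- by rewrite orbC; apply: same.
- by rewrite orbC; apply: diff.
Qed.

(* At the distance [q] from the leader [l] to [i], no walk of length [q] from
   [l] has reached a follower of the other cluster, and all walks of length [q]
   from [l] to the cluster of [l] have nonnegative weight. *)
Lemma herding_column (R : realType) n (A : 'M[R]_n) (V1 V2 L : {set 'I_n})
    (i l : 'I_n) :
    structurally_balanced_with A V1 V2 -> i \in V1 -> l \in V1 ->
    (dist A l i < +oo)%E ->
    (forall j, j \in V2 :\: L -> (dist A l i < dist A l j)%E) ->
  exists q, [/\ (q < n)%N, 0 < (A ^+ q) i l
    & forall j, j \notin L -> 0 <= (A ^+ q) j l].
Proof.
move=> [cov disj same diff] iV1 lV1 /dist_attained[q [qn wq distq]] far.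
have inV2 j : (j \in V2) = (j \notin V1).
  have /setP/(_ j) := cov; have /setP/(_ j) := disj; rewrite !inE.
  by case: (j \in V1); case: (j \in V2).
(* Structural balance says that conjugation by these signs turns [A] into its entrywise absolute
   value. *)
pose s j : R := if j \in V1 then 1 else -1.
have As k j : A k j = s k * s j * map_mx Num.norm A k j.
  rewrite mxE /s; have := same k j; have := diff k j; rewrite !inV2.
  case: (k \in V1); case: (j \in V1) => /= d e.
  - by rewrite ger0_norm ?e // !mul1r.
  - by rewrite ler0_norm ?d // mul1r mulN1r opprK.
  - by rewrite ler0_norm ?d // mulr1 mulN1r opprK.
  - by rewrite ger0_norm ?e // mulrNN !mul1r.
have Aq := exp_signed_mx _ As q.
have {}Aq j : (A ^+ q) j l = s j * (map_mx Num.norm A ^+ q) j l.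
  rewrite Aq ?{2}/s ?lV1 ?mulr1 // => k.
  by rewrite /s; case: ifP; rewrite ?mulrNN mulr1.
exists q; split=> // [|j jL].
  by rewrite Aq /s iV1 mul1r; apply/exp_absmx_gt0.
rewrite Aq /s; case: ifPn => jV1; first by rewrite mul1r exp_absmx_ge0.
suff /negP : ~ (0 < (map_mx Num.norm A ^+ q) j l).
  by rewrite lt0r exp_absmx_ge0 andbT negbK => /eqP ->; rewrite mulr0.
move/exp_absmx_gt0 => wj.
have : (dist A l j <= dist A l i)%E.
  by rewrite distq; apply: ereal_inf_lbound; exists q.
by apply/negP; rewrite -ltNge far // inE jL inV2.
Qed.

(** * A positive vector in the controllable subspace *)

Section PositiveVector.
Context {R : realType} {n : nat} (A : 'M[R]_n) (L : {set 'I_n}).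

(** A subspace given as a predicate, so that [positive_combination] serves discrete and continuous
    reachability alike. *)
Definition linear_pred m (P : 'cV[R]_m -> Prop) :=
  P 0 /\ forall (a : R) v w, P v -> P w -> P (a *: v + w).

Lemma linear_pred_sum m (P : 'cV[R]_m -> Prop) I (r : seq I) (Q : pred I)
    (a : I -> R) (F : I -> 'cV[R]_m) :
  linear_pred P -> (forall i, Q i -> P (F i)) ->
  P (\sum_(i <- r | Q i) a i *: F i).
Proof.
move=> [P0 PD] PF; elim: r => [|x r IH]; first by rewrite big_nil.
by rewrite big_cons; case: ifP => // Qx; apply: PD => //; apply: PF.
Qed.

Lemma positive_combination (P : 'cV[R]_n -> Prop) :
    (#|L| < n)%N -> linear_pred P ->
    (forall k l, (k < n)%N -> l \in L -> P (col l (A ^+ k))) ->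
    (forall i, i \notin L -> exists l q, [/\ l \in L, (q < n)%N,
       0 < (A ^+ q) i l & forall j, j \notin L -> 0 <= (A ^+ q) j l]) ->
  exists2 v, P v & forall i, 0 < v i 0.
Proof.
move=> Ln Plin PA herd.
have n_gt0 : (0 < n)%N by apply: leq_ltn_trans Ln.
have /choice[w Pw] : forall i, exists v : 'cV[R]_n, [/\ P v,
    i \notin L -> 0 < v i 0 & forall j, j \notin L -> 0 <= v j 0].
  move=> i; have [iL|/herd[l [q [lL qn qi qj]]]] := boolP (i \in L).
    by exists 0; split=> [|//|j _]; [case: Plin | rewrite mxE].
  exists (col l (A ^+ q)); split=> [|_|j jL]; first exact: PA.
    by rewrite mxE.
  by rewrite mxE qj.
pose W := \sum_i w i.
(* This exceeds every [- W i 0], so it outweighs any negative entry of [W] at a leader. *)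
pose c := 1 + \sum_i `|W i 0|.
exists (\sum_(l in L) c *: col l (A ^+ 0) + W).
  rewrite -[X in X + _]scale1r; case: (Plin) => _; apply.
    by apply: linear_pred_sum => // l lL; apply: PA.
  rewrite /W; under eq_bigr do rewrite -[w _]scale1r.
  by apply: linear_pred_sum => // i _; case: (Pw i).
have WE i : W i 0 = \sum_h w h i 0 by rewrite /W summxE.
move=> i; rewrite mxE summxE.
have eL : \sum_(l in L) (c *: col l (A ^+ 0)) i 0 = if i \in L then c else 0.
  rewrite (eq_bigr (fun l => if i == l then c else 0)); last first.
    by move=> l _; rewrite !mxE; case: eqP => _; rewrite /= ?mulr1 ?mulr0.
  rewrite -big_mkcondr /=; case: ifPn => iL.
    by rewrite (big_pred1 i) // => l /=; rewrite eq_sym; case: eqP => [->|];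
      rewrite ?iL ?andbF.
  by rewrite big1 // => l /andP[lL /eqP il]; rewrite il lL in iL.
rewrite eL; case: ifPn => iL.
  rewrite /c (bigD1 i) //= -addrA ltr_pwDl // addrAC addr_ge0 //.
    by rewrite -lerBlDr sub0r -normrN ler_norm.
  by rewrite sumr_ge0.
rewrite add0r WE (bigD1 i) //= ltr_pwDl //; first by case: (Pw i) => _ /(_ iL).
by rewrite sumr_ge0 // => h _; case: (Pw h) => _ _ /(_ i iL).
Qed.

End PositiveVector.

Lemma scale_above (R : realFieldType) n (v y : 'cV[R]_n) (h : R) :
  (forall i, 0 < v i 0) -> exists c, forall i, h <= c * v i 0 + y i 0.
Proof.
(* The sum of all the ratios stands in for their maximum: each is nonnegative. *)
move=> v_gt0; exists (\sum_i `|h - y i 0| / v i 0) => i.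
rewrite -lerBlDr (le_trans (ler_norm _)) // -ler_pdivrMr //.
rewrite (bigD1 i) //= lerDl sumr_ge0 // => j _.
by rewrite divr_ge0 // ltW.
Qed.

(** * Discrete-time reachability *)

Section DiscreteTime.
Context {R : realType} {n m : nat} (A : 'M[R]_n) (B : 'M[R]_(n, m)).

Definition dt_flow (x0 : 'cV[R]_n) (u : nat -> 'cV[R]_m) (t : nat) : 'cV[R]_n :=
  iteri t (fun s x => A *m x + B *m u s) x0.

Lemma dt_flowS x0 u t : dt_flow x0 u t.+1 = A *m dt_flow x0 u t + B *m u t.
Proof. by []. Qed.

Lemma dt_flow_linear a x y u w t :
  dt_flow (a *: x + y) (fun s => a *: u s + w s) t =
  a *: dt_flow x u t + dt_flow y w t.
Proof.
elim: t => //= t ->.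
by rewrite !mulmxDr -!scalemxAr scalerDr addrACA.
Qed.

Definition dt_reach (N : nat) (v : 'cV[R]_n) : Prop :=
  exists u, dt_flow 0 u N = v.

Lemma dt_reach_linear N : linear_pred (dt_reach N).
Proof.
have flow0 t : dt_flow 0 (fun=> 0) t = 0.
  by elim: t => //= t ->; rewrite !mulmx0 addr0.
split=> [|a _ _ [u <-] [w <-]]; first by exists (fun=> 0).
exists (fun s => a *: u s + w s).
by rewrite -dt_flow_linear scaler0 addr0.
Qed.

(** An impulse [w] at time 0 followed by zero input gives this vector at time [k.+1]; for larger [N]
    the input is delayed. *)
Lemma dt_reach_exp N k w : (k < N)%N -> dt_reach N (A ^+ k *m (B *m w)).
Proof.
elim: N => // N IH kN.
have [->|kN'] := eqVneq k N.
  exists (fun s => if s == 0%N then w else 0).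
  elim: N {IH kN} => [|N IH].
    by rewrite /dt_flow /= mulmx0 add0r expr0 mul1mx.
  rewrite dt_flowS IH /= mulmx0 addr0 mulmxA.
  by rewrite exprS.
have /IH[u uN] : (k < N)%N by rewrite ltn_neqAle kN' -ltnS.
exists (fun s => if s is s'.+1 then u s' else 0); rewrite -uN.
elim: N {IH kN kN' uN} => [|N IH]; first by rewrite /dt_flow /= !mulmx0 addr0.
by rewrite dt_flowS IH.
Qed.

Lemma dt_herdable_reach N v : (0 < N)%N -> dt_reach N v ->
  (forall i, 0 < v i 0) -> dt_herdable A B.
Proof.
move=> N_gt0 [u uv] v_gt0 x0 h _.
have [c hc] := scale_above (dt_flow x0 (fun=> 0) N) h v_gt0.
pose w s := c *: u s + 0 : 'cV[R]_m.
exists N, w, (dt_flow x0 w); split=> // i.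
(* The initial state is written as [c *: 0 + x0], the form required by [dt_flow_linear]. *)
rewrite /w -[x0](add0r x0) -[0 + x0](congr1 (+%R^~ x0) (scaler0 _ c)).
by rewrite dt_flow_linear uv !mxE.
Qed.

End DiscreteTime.

Lemma selection_mx_delta (R : realType) n (L : {set 'I_n}) l (lL : l \in L) :
  selection_mx R L *m delta_mx (enum_rank_in lL l) 0 =
  delta_mx l 0 :> 'cV[R]_n.
Proof.
apply/matrixP => i j; rewrite -colE !mxE enum_rankK_in //.
by rewrite ord1 andbT eq_sym // eq_sym.
Qed.

(** * The free response as an entrywise power series *)

Section PowerSeries.
Context {R : realType} {n : nat} (A : 'M[R]_n).

(* Coefficients of the [i]-th entry of [exp (t A) x]. *)
Definition expmx_coef (x : 'cV[R]_n) (i : 'I_n) : R^nat :=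
  fun k => (A ^+ k *m x) i 0 / k`!%:R.

Definition free_response (x : 'cV[R]_n) (i : 'I_n) (t : R) : R :=
  limn (pseries (expmx_coef x i) t).

Lemma exp_mulmx_bound (x : 'cV[R]_n) : exists C M : R,
  [/\ 0 <= C, 0 <= M & forall k i, `|(A ^+ k *m x) i 0| <= C * M ^+ k].
Proof.
have sum_norm_ge (F : 'I_n -> R) i : `|F i| <= \sum_j `|F j|.
  by rewrite (bigD1 i) //= lerDl sumr_ge0.
(* [M] bounds every absolute row sum of [A], so each product with [A] costs at most a factor [M]. *)
pose C := \sum_j `|x j 0|; pose M := \sum_i \sum_j `|A i j|.
have C_ge0 : 0 <= C by rewrite sumr_ge0.
have M_ge0 : 0 <= M by apply: sumr_ge0 => i _; rewrite sumr_ge0.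
exists C, M; split=> // k.
elim: k => [|k IH] i.
  by rewrite !expr0 mul1mx mulr1 (sum_norm_ge (fun j => x j 0)).
rewrite exprS -mulmxA mxE (le_trans (ler_norm_sum _ _ _)) //.
apply: (@le_trans _ _ (\sum_j `|A i j| * (C * M ^+ k))).
  by apply: ler_sum => j _; rewrite normrM ler_wpM2l.
rewrite -mulr_suml exprS [leRHS]mulrCA ler_wpM2r ?mulr_ge0 ?exprn_ge0 //.
rewrite /M [leRHS](bigD1 i) //= lerDl sumr_ge0 // => j _.
exact: sumr_ge0.
Qed.

Lemma is_cvg_expmx x i t : cvgn (pseries (expmx_coef x i) t).
Proof.
have [C [M [C_ge0 M_ge0 bound]]] := exp_mulmx_bound x.
apply: normed_cvg.
(* Comparison with [C] times the exponential series at [M * |t|]. *)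
apply: (@series_le_cvg _ _ (fun k => C * exp_coeff (M * `|t|) k)) => [k|k|k|].
- exact: normr_ge0.
- by rewrite mulr_ge0 // /exp_coeff /= divr_ge0 // exprn_ge0 // mulr_ge0.
- rewrite /expmx_coef /exp_coeff /= !normrM normfV normr_nat normrX exprMn.
  by rewrite mulrAC !mulrA -!(mulrA _ (`|t| ^+ k)) ler_wpM2r.
- exact/is_cvg_seriesZ/is_cvg_series_exp_coeff.
Qed.

Lemma exp_mulmxSr k (x : 'cV[R]_n) : A ^+ k *m (A *m x) = A ^+ k.+1 *m x.
Proof. by rewrite exprSr -mulmxA. Qed.

(** The factor [k.+1] from differentiation cancels against the factorial, leaving one more factor
    [A]. *)
Lemma pseries_diffs_expmx x i :
  pseries_diffs (expmx_coef x i) = expmx_coef (A *m x) i.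
Proof.
apply/funext => k; rewrite /pseries_diffs /expmx_coef exp_mulmxSr factS.
by rewrite natrM invfM mulrCA (mulrA k.+1%:R) mulfV ?pnatr_eq0 // mul1r.
Qed.

Lemma is_derive_free_response x i (t : R) :
  is_derive t (1 : R) (free_response x i) (free_response (A *m x) i t).
Proof.
rewrite /free_response -pseries_diffs_expmx.
apply: (@pseries_snd_diffs _ _ (`|t| + 1)).
- exact: is_cvg_expmx.
- by rewrite pseries_diffs_expmx; exact: is_cvg_expmx.
- by rewrite !pseries_diffs_expmx; exact: is_cvg_expmx.
- by rewrite (@ger0_norm _ (`|t| + 1)) ?addr_ge0 // ltrDl.
Qed.

(** [A] commutes with its powers; this brings the derivative found above into the form of the state
    equation. *)
Lemma free_response_mulmx x i t :
  free_response (A *m x) i t = \sum_j A i j * free_response x j t.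
Proof.
apply/cvg_lim => //.
have -> : pseries (expmx_coef (A *m x) i) t =
    fun N => \sum_j A i j * pseries (expmx_coef x j) t N.
  apply/funext => N; rewrite /pseries /series /=.
  under [RHS]eq_bigr do rewrite mulr_sumr.
  rewrite exchange_big /=; apply: eq_bigr => k _.
  rewrite /expmx_coef exp_mulmxSr exprS -mulmxA mxE !mulr_suml.
  by apply: eq_bigr => j _; rewrite !mulrA.
apply: cvg_big => [|j _]; first exact: add_continuous.
by apply: cvgMl_tmp; exact: is_cvg_expmx.
Qed.

Lemma free_response0 x i : free_response x i 0 = x i 0.
Proof.
apply/cvg_lim => //; apply/cvgrPdist_lt => e e_gt0.
near=> N.
have -> : pseries (expmx_coef x i) 0 N = x i 0; last by rewrite subrr normr0.
have /prednK <- : (0 < N)%N by near: N; exists 1%N.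
rewrite /pseries /series /= big_nat_recl // big1 => [|k _].
  by rewrite /expmx_coef /= !expr0 mul1mx fact0 divr1 mulr1 addr0.
by rewrite expr0n mulr0.
Unshelve. all: by end_near. Qed.

End PowerSeries.

(** * Flat outputs and derivatives at multiple roots *)

Section FlatPolynomials.
Context {R : realType} (p : {poly R}).

(* The Horner-type differential operators [sum_j p_(k+j) D^j] satisfy
   [D (flat k.+1) = flat k - p_k]; with [p] annihilating [A], the polynomial
   [sum_k (flat k.+1 psi) A^k b] is thus a trajectory for the input
   [flat 0 psi = p(D) psi]. *)
Definition flat (psi : {poly R}) (k : nat) : {poly R} :=
  \sum_(j < size p) p`_(k + j) *: psi^`(j).

Lemma flat_over psi k : (size p <= k)%N -> flat psi k = 0.
Proof.
move=> pk; apply: big1 => j _.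
by rewrite nth_default ?scale0r // (leq_trans pk) ?leq_addr.
Qed.

Lemma deriv_flat psi k : (flat psi k.+1)^`() = flat psi k - p`_k *: psi.
Proof.
have -> : flat psi k = \sum_(j < (size p).+1) p`_(k + j) *: psi^`(j).
  rewrite big_ord_recr /= [p`_(_ + size p)]nth_default ?leq_addl //.
  by rewrite scale0r addr0.
rewrite big_ord_recl addn0 addrAC subrr add0r raddf_sum /=.
by apply: eq_bigr => j _; rewrite derivZ -derivnS addSnnS.
Qed.

End FlatPolynomials.

(** Each derivative lowers the order of the root by one. The value of the cofactor at [a] is tracked
    because it yields the derivative of order [q] there. *)
Lemma derivn_XsubC_exp (R : comNzRingType) (a : R) (q i : nat) (g : {poly R}) :
    (i <= q)%N ->
  exists2 f : {poly R}, (('X - a%:P) ^+ q * g)^`(i) = ('X - a%:P) ^+ (q - i) * f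
    & f.[a] = (q ^_ i)%:R * g.[a].
Proof.
elim: i => [|i IH] iq.
  by exists g; rewrite ?subn0 // ffactn0 mul1r.
have [f fE fa] := IH (ltnW iq).
exists (f *+ (q - i) + ('X - a%:P) * f^`()).
  rewrite derivnS fE -(subnSK iq) derivM deriv_exp derivXsubC mul1r /=.
  by rewrite mulrDr mulrnAr mulrnAl mulrA -exprSr.
rewrite !hornerE /= subrr mul0r addr0 hornerMn fa ffactnSr natrM.
by rewrite -mulr_natl mulrA [_%:R * _%:R]mulrC.
Qed.

Lemma derivn_XsubC_exp_lt (R : comNzRingType) (a : R) (q i : nat)
    (g : {poly R}) :
  (i < q)%N -> (('X - a%:P) ^+ q * g)^`(i).[a] = 0.
Proof.
move=> iq; have [f -> _] := derivn_XsubC_exp a g (ltnW iq).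
by rewrite hornerM_comm ?horner_exp ?hornerXsubC ?subrr ?expr0n
  ?subn_eq0 1?leqNgt ?iq ?mul0r //; apply: mulrC.
Qed.

Lemma derivn_XsubC_exp_eq (R : comNzRingType) (a : R) (q : nat) (g : {poly R}) :
  (('X - a%:P) ^+ q * g)^`(q).[a] = q`!%:R * g.[a].
Proof.
have [f -> fa] := derivn_XsubC_exp a g (leqnn q).
by rewrite subnn expr0 mul1r fa ffactnn.
Qed.

(** * Continuous-time reachability *)

Section ContinuousTime.
Context {R : realType} {n m : nat} (A : 'M[R]_n) (B : 'M[R]_(n, m)).

(** Only polynomial trajectories from the origin on the time interval from 0 to 1 are considered,
    which makes the state equation an identity of polynomials. *)
Definition ct_reach (v : 'cV[R]_n) : Prop :=
  exists (X : 'I_n -> {poly R}) (U : 'I_m -> {poly R}),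
    [/\ forall i, (X i)^`() = \sum_j A i j *: X j + \sum_k B i k *: U k,
        forall i, (X i).[0] = 0
      & forall i, (X i).[1] = v i 0].

Lemma ct_reach_linear : linear_pred ct_reach.
Proof.
split=> [|a v w [X [U [XU X0 X1]]] [Y [V [YV Y0 Y1]]]].
  exists (fun=> 0), (fun=> 0); split=> i; rewrite ?horner0 ?mxE //.
  by rewrite deriv0 !big1 ?addr0 // => j _; rewrite scaler0.
exists (fun i => a *: X i + Y i), (fun k => a *: U k + V k).
split=> i; rewrite ?hornerD ?hornerZ ?X0 ?Y0 ?mulr0 ?addr0 ?X1 ?Y1 ?mxE //.
rewrite derivD derivZ XU YV scalerDr addrACA !scaler_sumr -!big_split /=.
by congr (_ + _); apply: eq_bigr => j _; rewrite scalerDr !scalerA mulrC.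
Qed.

Lemma ct_reach_flat (p psi : {poly R}) w :
    \sum_(k < size p) p`_k *: (A ^+ k *m (B *m w)) = 0 ->
    (forall k, (flat p psi k.+1).[0] = 0) ->
  ct_reach (\sum_(k < size p) (flat p psi k.+1).[1] *: (A ^+ k *m (B *m w))).
Proof.
pose c k i := (A ^+ k *m (B *m w)) i 0.
move=> pA0 flat0.
exists (fun i => \sum_(k < size p) c k i *: flat p psi k.+1).
exists (fun k => w k 0 *: flat p psi 0).
split=> i; last first.
- rewrite horner_sum summxE; apply: eq_bigr => k _.
  by rewrite hornerZ mxE mulrC.
- by rewrite horner_sum big1 // => k _; rewrite hornerZ flat0 mulr0.
have -> : \sum_k B i k *: (w k 0 *: flat p psi 0) = c 0%N i *: flat p psi 0.
  rewrite /c expr0 mul1mx mxE scaler_suml.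
  by apply: eq_bigr => k _; rewrite scalerA.
have -> : \sum_j A i j *: (\sum_(k < size p) c k j *: flat p psi k.+1) =
    \sum_(k < size p) c k.+1 i *: flat p psi k.+1.
  under eq_bigr do rewrite scaler_sumr.
  rewrite exchange_big /=; apply: eq_bigr => k _.
  rewrite /c exprS -mulmxA mxE scaler_suml.
  by apply: eq_bigr => j _; rewrite scalerA.
rewrite raddf_sum /=.
under eq_bigr do rewrite derivZ deriv_flat scalerBr scalerA.
rewrite big_split /= sumrN -scaler_suml.
(* The terms in [psi] left by [deriv_flat] add up to [p(A) B w], which vanishes. *)
have -> : \sum_(k < size p) c k i * p`_k = 0.
  have /matrixP/(_ i 0) := pA0; rewrite summxE [RHS]mxE; apply: etrans.
  by apply: eq_bigr => k _; rewrite mxE mulrC.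
rewrite scale0r subr0 addrC.
(* The input supplies the missing term [k = 0], and the surplus term [k = size p] vanishes by
   [flat_over]. *)
rewrite -(big_ord_recl _ (fun k : 'I_(size p).+1 => c k i *: flat p psi k)).
by rewrite big_ord_recr /= [flat _ _ (size p)]flat_over // scaler0 addr0.
Qed.

(* Take [psi = X^s (X - 1)^q] with [s = size p]: the state vanishes at time 0,
   and at time 1 it is a combination of the [A^j b], [j <= k], in which [A^k b]
   does occur. *)
Lemma ct_reach_exp (p : {poly R}) w :
    \sum_(k < size p) p`_k *: (A ^+ k *m (B *m w)) = 0 ->
  forall k, (k.+1 < size p)%N -> ct_reach (A ^+ k *m (B *m w)).
Proof.
move=> pA0; elim/ltn_ind=> k IH kp.
(* Here [k.+1 + q] is the degree of [p]: at time 1, only the leading coefficient of [p] meets a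
   nonzero derivative of [psi] in [flat p psi k.+1]. *)
pose s := size p; pose q := (s - k.+2)%N.
pose psi : {poly R} := 'X^s * ('X - 1%:P) ^+ q.
have psi0 j : (j < s)%N -> psi^`(j).[0] = 0.
  by move=> js; rewrite /psi -['X]subr0 -polyC0 derivn_XsubC_exp_lt.
have psi1 j : (j < q)%N -> psi^`(j).[1] = 0.
  by move=> jq; rewrite /psi mulrC derivn_XsubC_exp_lt.
have psi1q : psi^`(q).[1] != 0.
  rewrite /psi mulrC derivn_XsubC_exp_eq hornerXn expr1n mulr1.
  by rewrite pnatr_eq0 -lt0n fact_gt0.
have flat_gt h : (k < h)%N -> (flat p psi h.+1).[1] = 0.
  move=> kh; rewrite horner_sum big1 // => j _; rewrite hornerZ.
  have [jq|qj] := ltnP j q; first by rewrite psi1 // mulr0.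
  rewrite nth_default ?mul0r //; rewrite leq_subLR in qj.
  by rewrite (leq_trans qj) // leq_add2r.
have flat_eq : (flat p psi k.+1).[1] != 0.
  have qs : (q < size p)%N by rewrite ltn_subrL (leq_trans _ kp).
  rewrite horner_sum (bigD1 (Ordinal qs)) //= big1 ?addr0 => [|j jq].
    rewrite hornerZ mulf_neq0 //.
    have -> : (k.+1 + q = (size p).-1)%N.
      by rewrite -[in RHS](subnKC kp) addSn.
    by rewrite -lead_coefE lead_coef_eq0 -size_poly_gt0 (leq_trans _ kp).
  rewrite hornerZ; case: (ltngtP j q) => [jq'|jq'|jq'].
  - by rewrite psi1 // mulr0.
  - rewrite nth_default ?mul0r //.
    by rewrite ltn_subLR // in jq'.
  - by case/eqP: jq; apply: val_inj.
have flat0 h : (flat p psi h.+1).[0] = 0.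
  by rewrite horner_sum big1 // => j _; rewrite hornerZ psi0 ?mulr0.
have := ct_reach_flat pA0 flat0.
have kp' := ltnW kp; rewrite (bigD1 (Ordinal kp')) //=.
set S := \sum_(_ < _ | _) _ => reachS.
have linP := ct_reach_linear; have [P0 PD] := linP.
(* The terms below [k] are reachable by induction, and those above [k] vanish by [flat_gt]. *)
have reachSk : ct_reach S.
  rewrite /S (bigID (fun h : 'I_(size p) => (h < k)%N)) /=.
  rewrite [X in _ + X]big1 ?addr0 => [|h /andP[hk kh]].
    apply: linear_pred_sum => // h /andP[_ hk].
    by apply: IH => //; apply: leq_ltn_trans hk kp'.
  rewrite flat_gt ?scale0r // ltn_neqAle leqNgt kh andbT eq_sym.
  by apply: contra hk => /eqP hk; apply/eqP/val_inj.
have := PD _ _ _ (PD (-1) _ _ reachSk reachS) P0.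
move=> /(_ (flat p psi k.+1).[1]^-1).
by rewrite addr0 scaleN1r (addrC (- S)) addrK scalerA mulVf // scale1r.
Qed.

End ContinuousTime.

Lemma ct_reach_exp_lt (R : realType) n m (A : 'M[R]_n) (B : 'M[R]_(n, m)) k w :
  (k < n)%N -> ct_reach A B (A ^+ k *m (B *m w)).
Proof.
(* No [k < n] exists in dimension 0; in dimension [n.+1] the characteristic polynomial has size
   [n.+2], which covers all [k <= n]. *)
case: n A B => // n A B kn.
apply: (@ct_reach_exp _ _ _ A B (char_poly A)); last by rewrite size_char_poly.
have CH := Cayley_Hamilton A.
transitivity (horner_mx A (char_poly A) *m (B *m w)); last first.
  by rewrite CH mul0mx.
rewrite -[in RHS](coefK (char_poly A)) poly_def rmorph_sum /= mulmx_suml.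
apply: eq_bigr => j _.
by rewrite horner_mxZ rmorphXn /= horner_mx_X -scalemxAl.
Qed.

Lemma ct_herdable_reach (R : realType) n m (A : 'M[R]_n) (B : 'M[R]_(n, m)) v :
  ct_reach A B v -> (forall i, 0 < v i 0) -> ct_herdable A B.
Proof.
move=> [X [U [XU X0 X1]]] v_gt0 x0 h _.
have [c hc] := scale_above (\col_i free_response A x0 i 1) h v_gt0.
pose x t : 'cV[R]_n := \col_i ((c *: X i).[t] + free_response A x0 i t).
pose u t : 'cV[R]_m := \col_k (c *: U k).[t].
have derx t i : is_derive t (1 : R) (fun s => x s i 0)
    ((A *m x t + B *m u t) i 0).
  have -> : (fun s => x s i 0) = horner (c *: X i) + free_response A x0 i.
    by apply/funext => s; rewrite mxE.
  apply: (is_derive_eq (is_deriveD (is_derive_poly _ _)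
    (is_derive_free_response _ _ _ _))).
  rewrite derivZ XU scalerDr hornerD free_response_mulmx addrAC !mxE.
  congr (_ + _).
    rewrite hornerZ horner_sum mulr_sumr -big_split /=.
    by apply: eq_bigr => j _; rewrite mxE !hornerZ mulrDr mulrCA.
  rewrite hornerZ horner_sum mulr_sumr.
  by apply: eq_bigr => j _; rewrite mxE !hornerZ mulrCA.
exists 1, u, x; split=> //.
- split=> [k|i|t _ i //].
  + apply: continuous_subspaceT.
    have -> : (fun t => u t k 0) = horner (c *: U k).
      by apply/funext => t; rewrite mxE.
    exact: continuous_horner.
  + by apply: derivable_within_continuous => t _; case: (derx t i).
- apply/matrixP => i j; rewrite ord1 mxE hornerZ X0 mulr0 add0r.
  exact: free_response0.
- by move=> i; have := hc i; rewrite !mxE hornerZ X1.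
Qed.

(* [dist A l i < +oo] follows from the strict inequalities unless the set of
   competing nodes [j] is empty, where it is the convention min(empty) = +oo. *)
Theorem proposition4 (R : realType) (n : nat) (A : 'M[R]_n)
    (V1 V2 L : {set 'I_n})
    (A_balanced : structurally_balanced_with A V1 V2)
    (L_lt_n : (#|L| < n)%N)
    (L_meets_V1 : L :&: V1 != finset.set0)
    (L_meets_V2 : L :&: V2 != finset.set0)
    (cond_a : forall i : 'I_n, i \in V1 :\: L ->
       exists l : 'I_n, [/\ l \in L :&: V1, (dist A l i < +oo)%E
         & forall j : 'I_n, j \in V2 :\: L -> (dist A l i < dist A l j)%E])
    (cond_b : forall i : 'I_n, i \in V2 :\: L ->
       exists l : 'I_n, [/\ l \in L :&: V2, (dist A l i < +oo)%E
         & forall j : 'I_n, j \in V1 :\: L -> (dist A l i < dist A l j)%E]) :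
  herdable A (selection_mx R L).
Proof.
have n_gt0 : (0 < n)%N by apply: leq_ltn_trans L_lt_n.
have herd i : i \notin L -> exists l q, [/\ l \in L, (q < n)%N,
    0 < (A ^+ q) i l & forall j, j \notin L -> 0 <= (A ^+ q) j l].
  move=> iL; case: (A_balanced) => cov _ _ _.
  have /setP/(_ i) := cov; rewrite !inE => /orP[] iV.
  - have [|l [/setIP[lL lV] lfin far]] := cond_a i; first by rewrite inE iL.
    by have [q []] := herding_column A_balanced iV lV lfin far; exists l, q.
  - have [|l [/setIP[lL lV] lfin far]] := cond_b i; first by rewrite inE iL.
    have [q []] := herding_column (structurally_balancedC A_balanced) iV lV
      lfin far.
    by exists l, q.
(* Leader columns take the form [A ^+ k *m (B *m w)] on which both reachability lemmas are
   stated. *)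
have leader_colE k l (lL : l \in L) : col l (A ^+ k) =
    A ^+ k *m (selection_mx R L *m delta_mx (enum_rank_in lL l) 0).
  by rewrite selection_mx_delta colE.
split.
- have [|v reachv v_gt0] := positive_combination L_lt_n
    (ct_reach_linear A (selection_mx R L)) _ herd.
    by move=> k l kn lL; rewrite (leader_colE _ _ lL); apply: ct_reach_exp_lt.
  exact: ct_herdable_reach reachv v_gt0.
- have [|v reachv v_gt0] := positive_combination L_lt_n
    (dt_reach_linear A (selection_mx R L) n) _ herd.
    by move=> k l kn lL; rewrite (leader_colE _ _ lL); apply: dt_reach_exp.
  exact: dt_herdable_reach n_gt0 reachv v_gt0.
Qed.
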